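(* For integers $n\ge2$ and $0\le t\le n-1$, the number of $(102,110)$-avoiding inversion sequences $e$ of length $n$ with $\mathrm{rank}(e)=t$ is $$\binom{2n-t-2}{n-t-1}-\sum_{i=2}^{n-t}\binom{2n-t-2i}{n-t-i}.$$ (A sum whose upper limit is less than its lower limit is $0$.)
   Context: An inversion sequence of length $n$ is an integer sequence $e=(e_1,\dots,e_n)$ with $0\le e_j\le j-1$ for all $j$. It contains a pattern $w=w_1w_2w_3$ if there are indices $i_1<i_2<i_3$ such that $e_{i_1}e_{i_2}e_{i_3}$ is order-isomorphic to $w$ (same relations $<,=,>$ between corresponding pairs of entries); otherwise it avoids $w$. ''$(w,w')$-avoiding'' means avoiding both $w$ and $w'$. $\max(e)$ is the largest entry, and $\mathrm{fdes}(e)$ is the position $p$ of the first descent: $e_1\le\cdots\le e_p>e_{p+1}$, with the convention $e_{n+1}=-1$. For a $102$-avoiding $e$, $\mathrm{rank}(e):=\mathrm{fdes}(e)-\max(e)-1$. *)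

(* Defs.v *)
From mathcomp Require Import all_boot all_order all_algebra.

Set Implicit Arguments.
Unset Strict Implicit.
Unset Printing Implicit Defensive.

Import Order.TTheory GRing.Theory Num.Theory.

(* A sequence e_1, ..., e_n with entries in {0, ..., n-1} is a finite function  *)
(* e : {ffun 'I_n -> 'I_n}, where e j stands for e_{j+1}; the inversion         *)
(* sequence condition 0 <= e_j <= j-1 then reads e j <= j, so restricting the   *)
(* entries to 'I_n loses no inversion sequence.                                 *)

Definition is_invseq (n : nat) (e : {ffun 'I_n -> 'I_n}) : bool :=
  [forall j : 'I_n, e j <= j].

Definition order_iso (k : nat) (s w : k.-tuple nat) : bool :=
  [forall a : 'I_k, forall b : 'I_k,
     ((tnth s a < tnth s b) == (tnth w a < tnth w b)) &&
     ((tnth s a == tnth s b) == (tnth w a == tnth w b))].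

Definition contains (n : nat) (e : {ffun 'I_n -> 'I_n}) (w : 3.-tuple nat) :
    bool :=
  [exists i1 : 'I_n, exists i2 : 'I_n, exists i3 : 'I_n,
     [&& i1 < i2, i2 < i3 &
         order_iso [tuple e i1 : nat; e i2 : nat; e i3 : nat] w]].

Definition avoids (n : nat) (e : {ffun 'I_n -> 'I_n}) (w : 3.-tuple nat) :
    bool :=
  ~~ contains e w.

Definition maxe (n : nat) (e : {ffun 'I_n -> 'I_n}) : nat :=
  \max_(j < n) (e j : nat).

(* The value e_{i+1}, extended by e_{n+1} = -1.                                 *)
Definition entry (n : nat) (e : {ffun 'I_n -> 'I_n}) (i : nat) : int :=
  if insub i is Some j then Posz (e j : 'I_n) else (-1)%R.

(* The successor turns the 0-based index returned by find into a position in    *)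
(* {1, ..., n}. For n > 0 find succeeds, since e_n > e_{n+1} = -1.              *)
Definition fdes (n : nat) (e : {ffun 'I_n -> 'I_n}) : nat :=
  (find (fun i => (entry e i.+1 < entry e i)%R) (iota 0 n)).+1.

Definition rank (n : nat) (e : {ffun 'I_n -> 'I_n}) : int :=
  (Posz (fdes e) - Posz (maxe e) - 1)%R.

(* Main.v *)
Require Import Defs.
From mathcomp Require Import all_boot all_order all_algebra.
From mathcomp Require Import zify.

Set Implicit Arguments.
Unset Strict Implicit.
Unset Printing Implicit Defensive.

(* Let R be the largest repeated value of a sequence (0 if none) and            *)
(* R = p_0 < p_1 < ... < p_s the values present above it, up to the smallest    *)
(* value followed by a smaller one (up to the maximum, if there is no descent). *)
(* After a descent the entries that may be appended are exactly those of        *)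
(* [R, p_s], so the number of continuations depends only on the gap sizes       *)
(* g_i = p_i - p_{i-1} - 1. The weakly increasing prefix contributes its slack  *)
(* p - e_p - 1, which at the first descent is the rank.                         *)
(*                                                                              *)
(* With x marking length and z = x C(x), C the Catalan series, the prefixes     *)
(* ending in a repetition at slack t have generating function x z^t, so a gap   *)
(* g has weight z^g. Let c_s be (1 - z)^s times the generating function of      *)
(* continuations summed over s gaps. Splitting a gap or reusing a present value *)
(* gives c_s - c_{s-1} = x c_1 + z^2 c_{s+1}; in the sum of the z^s c_s that is *)
(* needed, c_1 cancels because x = z (1 - z), leaving a closed form.            *)

(** * Counting by gaps *)

(** A value below a repeated one completes 110, and a value above one already followed by something
    smaller completes 102. Past the first descent nothing else is excluded, the bound on inversion
    sequences being automatic there ([gap_state_low], [pattern_free_high], [gap_state_free],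
    [past_descent_le]). Hence [extensions_ascending]: the sequences are counted by [completions],
    from slack and gaps alone.

    Cutting at the first descent, [completionsE] writes the count for rank t as a ballot number, for
    the weakly increasing sequences, plus a sum S(t) of [descsum] over the positions of the descent.
    By [descsum_shift], S(t) is 2 S(t+1) plus a sum of ballot numbers, which the binomials
    [desc_increment] solve ([sum_descsum]). With [prefixesE] for the ballot number,
    [sum_bin_telescope] yields the closed form. *)

Lemma sum_ord_extend (m N : nat) (f : nat -> nat) :
  m <= N -> (forall i, m <= i -> f i = 0) ->
  \sum_(i < N) f i = \sum_(i < m) f i.
Proof.
move=> lemN f0; rewrite -!(big_mkord xpredT f) (big_cat_nat (n := m)) //=.
by rewrite [X in _ + X]big_nat_cond [X in _ + X]big1 ?addn0 // => i /andP[/andP[/f0]].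
Qed.

(** A gap g that receives a new value splits into a and b with a + b + 1 = g; the sum is reindexed
    by the two pieces. *)
Lemma sum_triangle (N : nat) (f : nat -> nat -> nat) :
  (forall a b, N <= a + b + 1 -> f a b = 0) ->
  \sum_(g < N) \sum_(a < g) f a (g - a.+1) = \sum_(a < N) \sum_(b < N) f a b.
Proof.
elim: N f => [|N IHN] f f0; first by rewrite !big_ord0.
rewrite big_ord_recl big_ord0 add0n.
have -> : \sum_(i < N) \sum_(a < lift ord0 i) f a (lift ord0 i - a.+1)
   = \sum_(i < N) (f 0 i + \sum_(a < i) f a.+1 (i - a.+1)).
  apply: eq_bigr => i _; rewrite /= big_ord_recl /= /bump !add1n subn1.
  by congr (_ + _); apply: eq_bigr => a _; rewrite add1n.
rewrite big_split /= (IHN (fun a => f a.+1)); last first.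
  by move=> a b le_N; apply: f0; lia.
rewrite [RHS]big_ord_recl; congr (_ + _).
  rewrite [RHS]big_ord_recr /= [X in _ + X]f0 ?addn0 //; lia.
apply: eq_bigr => a _; rewrite big_ord_recr /= [X in _ = _ + X]f0 ?addn0 //.
by lia.
Qed.

(* Number of weakly increasing inversion sequences of length n and slack        *)
(* n - 1 - e_n = t whose last entry is a repetition, or n = 1; the coefficient  *)
(* of x^n in x z^t.                                                             *)
Fixpoint prefixes (n t : nat) : nat :=
  match n, t with
  | 0, _ => 0
  | m.+1, 0 => m == 0
  | m.+1, r.+1 => \sum_(g < m) prefixes m (r + g)
  end.

Lemma prefixes_eq0 n t : n <= t -> prefixes n t = 0.
Proof.
elim: n t => [|n IHn] [|t] //= le_nt.
by rewrite big1 // => g _; apply: IHn; lia.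
Qed.

(* x z^t / (1 - z) = z^{t+1}, that is x = z (1 - z).                            *)
Lemma sum_prefixes N n t : n <= N -> \sum_(g < N) prefixes n (t + g) = prefixes n.+1 t.+1.
Proof.
move=> leN; rewrite (sum_ord_extend (m := n) (f := fun g => prefixes n (t + g))) //.
by move=> i le_ni; apply: prefixes_eq0; lia.
Qed.

Lemma prefixesS n t : prefixes n.+1 t.+1 = prefixes n t + prefixes n.+1 t.+2.
Proof.
rewrite -(@sum_prefixes n.+1 n t) // -(@sum_prefixes n n t.+1) // big_ord_recl addn0.
by congr (_ + _); apply: eq_bigr => i _; rewrite /= /bump addSnnS.
Qed.

(* Sum of f over the lists of s gaps, weighted by the number of prefixes that   *)
(* reach them: the coefficient of x^n in x^{s+1} z^t \sum_gs f(gs) z^{|gs|}.    *)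
(* The bound N on the gaps is immaterial as soon as n <= N.                     *)
Fixpoint gapsum (N s : nat) (f : seq nat -> nat) (n t : nat) : nat :=
  if s is r.+1
  then \sum_(g < N) gapsum N r (fun gs => f (rcons gs g)) n.-1 (t + g)
  else f [::] * prefixes n t.

Lemma eq_gapsum N s f1 f2 n t :
  (forall gs, size gs = s -> f1 gs = f2 gs) ->
  gapsum N s f1 n t = gapsum N s f2 n t.
Proof.
elim: s f1 f2 n t => [|s IHs] f1 f2 n t eq_f /=; first by rewrite eq_f.
apply: eq_bigr => g _; apply: IHs => gs sz_gs; apply: eq_f.
by rewrite size_rcons sz_gs.
Qed.

Lemma gapsum_eq0 N s f n t : n <= s + t -> gapsum N s f n t = 0.
Proof.
elim: s f n t => [|s IHs] f n t le_n /=; first by rewrite prefixes_eq0 ?muln0.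
by rewrite big1 // => g _; apply: IHs; lia.
Qed.

Lemma gapsumD N s f1 f2 n t :
  gapsum N s (fun gs => f1 gs + f2 gs) n t = gapsum N s f1 n t + gapsum N s f2 n t.
Proof.
elim: s f1 f2 n t => [|s IHs] f1 f2 n t /=; first by rewrite mulnDl.
by rewrite -big_split; apply: eq_bigr => g _; rewrite /= IHs.
Qed.

Lemma gapsumM N s c f n t :
  gapsum N s (fun gs => c * f gs) n t = c * gapsum N s f n t.
Proof.
elim: s f n t => [|s IHs] f n t /=; first by rewrite mulnA.
by rewrite big_distrr; apply: eq_bigr => g _; rewrite /= IHs.
Qed.

Lemma gapsum_sum N s m (f : nat -> seq nat -> nat) n t :
  gapsum N s (fun gs => \sum_(i < m) f i gs) n t = \sum_(i < m) gapsum N s (f i) n t.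
Proof.
elim: m => [|m IHm].
  rewrite big_ord0 (@eq_gapsum _ _ _ (fun gs => 0 * 0)) ?gapsumM ?mul0n //.
  by move=> gs _; rewrite big_ord0.
rewrite (@eq_gapsum _ _ _ (fun gs => \sum_(i < m) f i gs + f m gs)).
  by rewrite gapsumD IHm big_ord_recr.
by move=> gs _; rewrite big_ord_recr.
Qed.

(** The geometric sum 1 / (1 - z), multiplied by x, is z. *)
Lemma sum_gapsum N s f n t : n <= N ->
  \sum_(g < N) gapsum N s f n (t + g) = gapsum N s f n.+1 t.+1.
Proof.
elim: s f n t => [|s IHs] f n t leN.
  by rewrite /= -big_distrr sum_prefixes.
case: n leN => [_|n leN].
  by rewrite big1 => [|g _]; rewrite gapsum_eq0.
rewrite /= exchange_big; apply: eq_bigr => g _ /=.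
rewrite addSn -IHs; last exact: ltnW.
by apply: eq_bigr => h _; rewrite addnAC.
Qed.

(** Each of the s - j gaps that f does not read contributes x / (1 - z) = z. *)
Lemma gapsum_take N s j f n t : n <= N -> j <= s ->
  gapsum N s (fun gs => f (take j gs)) n t = gapsum N j f n (t + (s - j)).
Proof.
elim: s n t => [|s IHs] n t leN; first by rewrite leqn0 => /eqP->; rewrite addn0.
rewrite leq_eqVlt => /orP[/eqP-> | ltj].
  rewrite subnn addn0; apply: eq_gapsum => gs sz_gs.
  by rewrite take_oversize ?sz_gs.
case: n leN => [_|n leN]; first by rewrite !gapsum_eq0.
rewrite [LHS]/=.
have -> : \sum_(g < N) gapsum N s (fun gs => f (take j (rcons gs g))) n (t + g) =
  \sum_(g < N) gapsum N j f n (t + (s - j) + g).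
  apply: eq_bigr => g _; rewrite -addnAC -IHs //; last exact: ltnW.
  apply: eq_gapsum => gs sz_gs; rewrite -cats1 takel_cat ?sz_gs //.
by rewrite sum_gapsum 1?ltnW // subSn // addnS.
Qed.

Lemma gapsum_cst N s c n t : n <= N ->
  gapsum N s (fun=> c) n t = c * prefixes n (t + s).
Proof. by move=> leN; rewrite (@gapsum_take _ _ 0 (fun=> c)) // subn0. Qed.

Lemma gapsum_pick N s i (G : seq nat -> nat -> nat) n t : n <= N -> i < s ->
  gapsum N s (fun gs => G (take i gs) (nth 0 gs i)) n t =
  \sum_(g < N) gapsum N i (G^~ g) n.-1 (t + (s - i.+1) + g).
Proof.
move=> leN lti.
pose f l := G (take i l) (nth 0 l i).
rewrite (@eq_gapsum _ _ _ (fun gs => f (take i.+1 gs))); last first.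
  by move=> gs _; rewrite /f nth_take // take_takel.
rewrite gapsum_take //=; apply: eq_bigr => g _; apply: eq_gapsum => gs sz_gs.
by rewrite /f -cats1 take_size_cat // nth_cat sz_gs ltnn subnn.
Qed.

(** * Continuations after the first descent *)

(* Number of ways to append k entries, the first of them below the top value,   *)
(* to a state with gaps gs. Choosing the present value p_i keeps only the gap   *)
(* above it; choosing a new value keeps the lower gaps and splits its own. The  *)
(* successor accounts for continuing with copies of the top value.              *)
Fixpoint desc (k : nat) (gs : seq nat) : nat :=
  if k is j.+1
  then \sum_(i < size gs)
         ((desc j [:: nth 0 gs i]).+1 +
          \sum_(a < nth 0 gs i)
             (desc j (take i gs ++ [:: a : nat; nth 0 gs i - a.+1])).+1)
  else 0.

Lemma desc_nil k : desc k [::] = 0.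
Proof. by case: k => //= k; rewrite big_ord0. Qed.

Definition descsum (N k n t : nat) : nat := \sum_(s < N) gapsum N s (desc k) n t.

Lemma descsum_eq0 N k n t : n <= t -> descsum N k n t = 0.
Proof.
move=> le_nt; rewrite /descsum big1 // => s _; apply: gapsum_eq0.
exact: leq_trans (leq_addl _ _).
Qed.

Lemma descsum0 N n t : descsum N 0 n t = 0.
Proof.
rewrite /descsum big1 // => s _.
by rewrite (@eq_gapsum _ _ _ (fun=> 0 * 0)) // gapsumM.
Qed.

Lemma descsum_recl N k n t : n <= N ->
  descsum N k n t = \sum_(i < N) gapsum N i.+1 (desc k) n t.
Proof.
move=> leN; case: N leN => [|N] leN; first by rewrite /descsum !big_ord0.
rewrite /descsum big_ord_recl [X in X + _]/= desc_nil mul0n add0n.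
by rewrite [RHS]big_ord_recr [X in _ = _ + X]gapsum_eq0 ?addn0 //= (leq_trans leN) // leq_addr.
Qed.

(* Reusing a present value contributes exactly the missing term i = 0.          *)
Lemma descsum_gapsum N k n t : n.+1 < N ->
  descsum N k.+1 n t =
  \sum_(j < N) \sum_(i < N) gapsum N i.+1 (fun gs => (desc k gs).+1) n.+1 (t + j + 1).
Proof.
move=> ltN; have leN : n <= N by lia.
pose F gs := (desc k gs).+1.
pose G (l : seq nat) g := F [:: g] + \sum_(a < g) F (l ++ [:: a : nat; g - a.+1]).
(* Contribution of a chosen gap with i gaps below it and j above: reusing the value at its lower
   end, or splitting it. *)
pose X i j := gapsum N 1 F n (t + j + i) + gapsum N i.+2 F n.+1 (t + j + 1).
have pickE s i : i < s ->
    gapsum N s (fun gs => G (take i gs) (nth 0 gs i)) n t = X i (s - i.+1).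
  move=> lt_is; rewrite gapsum_pick // /X.
  have -> : gapsum N 1 F n (t + (s - i.+1) + i) =
     \sum_(g < N) gapsum N i (fun=> F [:: g : nat]) n.-1 (t + (s - i.+1) + g).
    rewrite /=; apply: eq_bigr => g _; rewrite gapsum_cst; last by lia.
    by rewrite addnAC.
  (* A split adds a gap without an ascent in the prefix and lowers the total gap size by one, so n
     and t both rise by one. *)
  have -> : gapsum N i.+2 F n.+1 (t + (s - i.+1) + 1) =
     \sum_(g < N) \sum_(a < g)
        gapsum N i (fun l => F (l ++ [:: a : nat; g - a.+1])) n.-1 (t + (s - i.+1) + g).
    pose Y a b := gapsum N i (fun l => F (l ++ [:: a; b])) n.-1
                    (t + (s - i.+1) + (a + b + 1)).
    transitivity (\sum_(a < N) \sum_(b < N) Y a b).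
      rewrite exchange_big; apply: eq_bigr => b _; apply: eq_bigr => a _ /=.
      rewrite /Y; have -> : t + (s - i.+1) + 1 + b + a = t + (s - i.+1) + (a + b + 1) by lia.
      by apply: eq_gapsum => gs _; rewrite -!cats1 -catA.
    rewrite -sum_triangle; last by move=> a b leab; apply: gapsum_eq0; lia.
    apply: eq_bigr => g _; apply: eq_bigr => a _; rewrite /Y; congr gapsum.
    by case: a => a /= lta; lia.
  rewrite -big_split; apply: eq_bigr => g _ /=.
  by rewrite gapsumD (@gapsum_sum _ _ _ (fun a l => F (l ++ [:: a; g - a.+1]))).
transitivity (\sum_(s < N) \sum_(i < s) X i (s - i.+1)).
  apply: eq_bigr => s _.
  rewrite (@eq_gapsum _ _ _
    (fun gs => \sum_(i < s) G (take i gs) (nth 0 gs i))).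
    rewrite (@gapsum_sum _ _ _ (fun i gs => G (take i gs) (nth 0 gs i))).
    by apply: eq_bigr => i _; rewrite pickE.
  by move=> gs <-.
have X0 a b : N <= a + b + 1 -> X a b = 0.
  by move=> leab; rewrite /X !gapsum_eq0 //; lia.
rewrite (sum_triangle X0) exchange_big; apply: eq_bigr => j _.
rewrite big_split (@sum_gapsum N 1 F n (t + j)) // -(addn1 (t + j)).
case: N {pickE X0 X} ltN leN j => [|N] // ltN leN j.
rewrite [RHS]big_ord_recl; congr (_ + _).
rewrite big_ord_recr -[RHS]addn0; congr (_ + _).
by apply: gapsum_eq0; rewrite /=; lia.
Qed.

Lemma descsumS N k n t : n.+1 < N ->
  descsum N k.+1 n t =
  \sum_(j < N) descsum N k n.+1 (t.+1 + j) + prefixes n.+3 t.+4.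
Proof.
move=> ltN; rewrite descsum_gapsum //.
rewrite -(@sum_prefixes N n.+2 t.+3) // -big_split; apply: eq_bigr => j _.
rewrite (addSn t.+2) -(@sum_prefixes N n.+1 (t.+2 + j)); last exact: ltnW.
rewrite descsum_recl; last exact: ltnW.
rewrite -big_split; apply: eq_bigr => i _.
rewrite (@eq_gapsum _ _ _ (fun gs => desc k gs + 1)); last by move=> gs _; rewrite addn1.
rewrite gapsumD; have -> : t + j + 1 = t.+1 + j by lia.
rewrite gapsum_cst ?mul1n; last exact: ltnW.
by congr (_ + prefixes _ _); lia.
Qed.

(** This is multiplication by 1 - z: subtracting [descsumS] at t + 1 leaves only the term j = 0. *)
Lemma descsum_shift N k n t : n.+2 < N ->
  descsum N k.+1 n t =
  descsum N k.+1 n t.+1 + descsum N k n.+1 t.+1 + prefixes n.+2 t.+3.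
Proof.
move=> ltN; rewrite !descsumS; try lia.
rewrite (prefixesS n.+2 t.+3).
suff -> : \sum_(j < N) descsum N k n.+1 (t.+1 + j) =
  descsum N k n.+1 t.+1 + \sum_(j < N) descsum N k n.+1 (t.+2 + j) by lia.
case: N ltN => [|N] // ltN; rewrite big_ord_recl addn0; congr (_ + _).
rewrite big_ord_recr [X in _ = _ + X]descsum_eq0 /= ?addn0; last by lia.
by apply: eq_bigr => i _; rewrite /bump; congr descsum; lia.
Qed.

Lemma sum_antidiag (N : nat) (f : nat -> nat -> nat) :
  (forall a b, N <= a + b -> f a b = 0) ->
  \sum_(s < N) \sum_(a < s.+1) f a (s - a) = \sum_(a < N) \sum_(b < N) f a b.
Proof.
(* The bound N + 1 lets [sum_triangle] apply with g = s + 1. *)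
move=> f0; transitivity (\sum_(a < N.+1) \sum_(b < N.+1) f a b).
  rewrite -sum_triangle => [|a b leN]; last by apply: f0; lia.
  rewrite [RHS]big_ord_recl big_ord0 add0n; apply: eq_bigr => s _.
  by apply: eq_bigr => a _; congr f.
rewrite (@sum_ord_extend N N.+1 (fun a => \sum_(b < N.+1) f a b)) //; last first.
  by move=> a leNa; rewrite big1 // => b _; apply: f0; lia.
apply: eq_bigr => a _; apply: (@sum_ord_extend N N.+1 (f a)) => // b leNb.
by apply: f0; lia.
Qed.

(** * Cutting a sequence at its first descent *)

(* Number of ways to append k entries to a weakly increasing sequence with the  *)
(* given slack and gaps, so that the rank of the result is t.                   *)
Fixpoint completions (t k slack : nat) (gs : seq nat) : nat :=
  if k is j.+1
  then completions t j slack.+1 [::] +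
       \sum_(g < slack.+1) completions t j (slack - g) (rcons gs g) +
       (slack == t) * desc k gs
  else slack == t.

(* Completions by k entries of all weakly increasing prefixes of length j.      *)
Definition statesum (N t k j : nat) : nat :=
  \sum_(c < N) \sum_(s < N) gapsum N s (completions t k c) j c.

(** A weakly increasing prefix of length j + 1 arises once from one of length j, by a repetition (s
    = 0) or an ascent (s > 0). A descent gives rank t only from slack t. *)
Lemma statesumS N t k j : j.+1 < N -> 0 < j -> t < N ->
  statesum N t k.+1 j = statesum N t k j.+1 + descsum N k.+1 j t.
Proof.
move=> ltjN j_gt0 ltN; have lejN : j <= N by lia.
pose X g c := \sum_(s < N) gapsum N s (fun gs => completions t k c (rcons gs g)) j (c + g).
have -> : statesum N t k.+1 j =
  \sum_(c < N) \sum_(s < N) gapsum N s (fun=> completions t k c.+1 [::]) j c +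
  \sum_(c < N) \sum_(g < c.+1) X g (c - g) +
  \sum_(c < N) (c == t :> nat) * descsum N k.+1 j c.
  rewrite -!big_split; apply: eq_bigr => c _ /=.
  rewrite /X exchange_big /descsum big_distrr -!big_split; apply: eq_bigr => s _ /=.
  rewrite gapsumD gapsumD gapsumM; congr (_ + _ + _).
  rewrite (@gapsum_sum _ _ _ (fun g gs => completions t k (c - g) (rcons gs g))).
  by apply: eq_bigr => g _; rewrite subnK // -ltnS.
rewrite sum_antidiag => [|g c leN]; last first.
  by rewrite /X big1 // => s _; apply: gapsum_eq0; lia.
congr (_ + _); last first.
  rewrite (bigD1 (Ordinal ltN)) //= eqxx mul1n big1 ?addn0 // => c neq_ct.
  by rewrite (negbTE (neq_ct : c != t :> nat)).
transitivity (\sum_(c < N) gapsum N 0 (completions t k c) j.+1 c +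
   \sum_(c < N) \sum_(i < N) gapsum N i.+1 (completions t k c) j.+1 c).
  congr (_ + _).
    transitivity (\sum_(c < N) completions t k c.+1 [::] * prefixes j.+1 c.+1).
      apply: eq_bigr => c _; rewrite -(@sum_prefixes N) // big_distrr.
      by apply: eq_bigr => s _; rewrite gapsum_cst.
    case: N ltjN {ltN lejN X} => [|N] // ltjN.
    rewrite big_ord_recr [RHS]big_ord_recl /=.
    case: j j_gt0 ltjN => // j _ ltjN.
    rewrite [\sum_(g < j.+1) _](_ : _ = prefixes j.+2 N.+1) // prefixes_eq0 ?muln0 ?addn0; last by lia.
    by rewrite add0n.
  by rewrite exchange_big; apply: eq_bigr => c _; rewrite /X exchange_big.
rewrite -big_split; apply: eq_bigr => c _.
case: N ltjN {ltN lejN X c} (c : nat) => [|N] // ltjN c.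
rewrite [RHS]big_ord_recl; congr (_ + _).
rewrite big_ord_recr -[RHS]addn0; congr (_ + _).
by apply: gapsum_eq0 => /=; lia.
Qed.

Lemma statesum_unroll N t k j : j + k < N -> 0 < j -> t < N ->
  statesum N t k j =
  statesum N t 0 (j + k) + \sum_(i < k) descsum N i.+1 (j + k - i.+1) t.
Proof.
elim: k j => [|k IHk] j ltN j_gt0 ltt; first by rewrite big_ord0 !addn0.
rewrite statesumS //; last by lia.
rewrite IHk //; last by lia.
rewrite addSnnS -addnA; congr (_ + _); rewrite big_ord_recr; congr (_ + _).
by congr descsum; rewrite /=; lia.
Qed.

Lemma completionsE N t m : m.+1 < N -> t < N ->
  completions t m 0 [::] =
  prefixes m.+2 t.+1 + \sum_(k < m) descsum N k.+1 (m - k) t.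
Proof.
(* The only prefix of length 1 has slack 0 and no gaps. *)
move=> ltN ltt; transitivity (statesum N t m 1).
  case: N ltN {ltt} => // N _; rewrite /statesum big_ord_recl [X in _ + X]big1.
    rewrite big_ord_recl big1 ?addn0 /= ?muln1 // => s _.
    by rewrite big1 // => g _; apply: gapsum_eq0.
  by move=> c _; rewrite big1 // => s _; apply: gapsum_eq0; rewrite /= /bump; lia.
rewrite statesum_unroll ?add1n //; congr (_ + _).
rewrite /statesum exchange_big -(@sum_prefixes N); last exact: ltnW.
apply: eq_bigr => s _; rewrite (bigD1 (Ordinal ltt)) //=.
rewrite (@eq_gapsum _ _ _ (fun=> 1)); last by move=> gs _; rewrite eqxx.
rewrite gapsum_cst ?mul1n; last exact: ltnW.
rewrite big1 ?addn0 // => c neq_ct.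
rewrite (@eq_gapsum _ _ _ (fun=> 0 * 0)) ?gapsumM // => gs _.
by rewrite (negbTE (neq_ct : c != t :> nat)).
Qed.

(** * Ballot numbers and binomial sums *)

(** Ballot numbers are differences of two binomials. [prefixesS] reduces (u, t) to (u, t - 1) and (u
    - 1, t + 2) in the notation used here, hence the nested induction. *)
Lemma prefixesE t u :
  prefixes (t + u).+2 t.+1 + (if u is v.+1 then 'C(t + 2 * u, v) else 0) = 'C(t + 2 * u, u).
Proof.
elim: u t => [|u IHu]; elim=> [|t IHt].
- by rewrite !addn0 bin0 prefixesS (@prefixes_eq0 2 2).
- rewrite !addn0 !bin0 in IHt *.
  by rewrite prefixesS IHt prefixes_eq0.
- rewrite prefixesS add0n (_ : prefixes u.+2 0 = 0) // add0n.
  have := IHu 1; rewrite add1n add0n (_ : 2 * u.+1 = (1 + 2 * u).+1); last by lia.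
  (* For t = 0 only the case of u with t = 1 remains; the two middle binomials of an odd row
     agree. *)
  have symC : 'C(1 + 2 * u, u.+1) = 'C(1 + 2 * u, u).
    by rewrite -bin_sub; [congr 'C(_, _); lia | lia].
  rewrite binS symC; case: u {IHu} symC => [|u] symC; last by rewrite binS; lia.
  by rewrite /= !bin0; lia.
- rewrite prefixesS; have := IHu t.+2; have := IHt.
  rewrite (_ : (t + u.+1).+2 = (t.+1 + u.+1).+1); last by lia.
  rewrite (_ : (t.+2 + u).+2 = (t.+1 + u.+1).+2); last by lia.
  rewrite (_ : t.+1 + 2 * u.+1 = (t + 2 * u.+1).+1); last by lia.
  rewrite (_ : t.+2 + 2 * u = t + 2 * u.+1); last by lia.
  case: u {IHu IHt} => [|u]; rewrite !binS ?bin0; lia.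
Qed.

(* Truncated subtraction would give 1 instead of 0 for v < t + 3.               *)
Definition desc_increment (v t : nat) : nat :=
  if t + 3 <= v then 'C(2 * v - t - 3, v - t - 3) else 0.

(** Pascal's rule gives C(M, w+1) + C(M, w), and the ballot number is C(M, w+1) - C(M, w). *)
Lemma desc_increment_rec v t :
  desc_increment v t = 2 * desc_increment v t.+1 + prefixes v.+1 t.+3.
Proof.
rewrite /desc_increment; case: (leqP (t + 3) v) => [le_v | lt_v]; last first.
  by rewrite (_ : (t.+1 + 3 <= v) = false) ?prefixes_eq0; lia.
rewrite -(subnK le_v); move: (v - _) => {v le_v} [|w].
  rewrite (_ : (t.+1 + 3 <= 0 + (t + 3)) = false); last by lia.
  have R0 : prefixes t.+4 t.+3 = 1 by have := prefixesE t.+2 0; rewrite !addn0 bin0.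
  rewrite (_ : 0 + (t + 3) - t - 3 = 0) ?bin0; last by lia.
  by rewrite muln0 add0n -R0; congr prefixes; lia.
rewrite (_ : (t.+1 + 3 <= _) = true); last by lia.
have := prefixesE t.+2 w.+1.
rewrite (_ : (t.+2 + w.+1).+2 = (w.+1 + (t + 3)).+1); last by lia.
rewrite (_ : 2 * (w.+1 + (t + 3)) - t - 3 = (t.+2 + 2 * w.+1).+1); last by lia.
rewrite (_ : w.+1 + (t + 3) - t - 3 = w.+1); last by lia.
rewrite (_ : 2 * (w.+1 + (t + 3)) - t.+1 - 3 = t.+2 + 2 * w.+1); last by lia.
rewrite (_ : w.+1 + (t + 3) - t.+1 - 3 = w); last by lia.
by rewrite binS; lia.
Qed.

(** With the total length fixed, both [descsum] terms of [descsum_shift] sum to the same value at t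
    + 1, the boundary terms being 0; this is the factor 2 of [desc_increment_rec]. The induction
    descends in t, from t >= m where both sides vanish. *)
Lemma sum_descsum N t m : m.+2 < N ->
  \sum_(k < m) descsum N k.+1 (m - k) t = \sum_(v < m.+2) desc_increment v t.
Proof.
move=> ltN; have [d] : exists d, m <= t + d by exists m; lia.
elim: d t => [|d IHd] t le_m.
  rewrite big1 => [|k _]; last by apply: descsum_eq0; lia.
  rewrite big1 // => v _; rewrite /desc_increment.
  by case: v => v /= ltv; case: leqP => //; lia.
have {IHd} IH := IHd t.+1 (leq_trans le_m (eq_leq (esym (addSnnS _ _)))).
transitivity (\sum_(k < m) descsum N k.+1 (m - k) t.+1 +
  \sum_(k < m) descsum N k (m - k).+1 t.+1 + \sum_(k < m) prefixes (m - k).+2 t.+3).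
  by rewrite -!big_split; apply: eq_bigr => k _; rewrite /= descsum_shift //; lia.
have -> : \sum_(k < m) descsum N k (m - k).+1 t.+1 =
   \sum_(k < m) descsum N k.+1 (m - k) t.+1.
  case: m {IH le_m} ltN => [|m] ltN; first by rewrite !big_ord0.
  rewrite big_ord_recl descsum0 add0n big_ord_recr /=.
  rewrite [X in _ + X]descsum_eq0 ?addn0; last by lia.
  by apply: eq_bigr => k _; rewrite /= /bump; congr descsum; case: k => k /= ltk; lia.
rewrite IH addnn -mul2n.
have -> : \sum_(k < m) prefixes (m - k).+2 t.+3 = \sum_(v < m.+2) prefixes v.+1 t.+3.
  rewrite 2!big_ord_recl !prefixes_eq0 // !add0n (reindex_inj rev_ord_inj).
  by apply: eq_bigr => k _; congr prefixes; case: k => k /= ltk; rewrite /bump; lia.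
by rewrite big_distrr -big_split; apply: eq_bigr => v _; rewrite [RHS]desc_increment_rec.
Qed.

(** Pascal's rule, applied twice to C(t+2m+4, m+1), splits off the new term of each sum. *)
Lemma sum_bin_telescope t m :
  \sum_(w < m) 'C(t + 2 * w + 3, w) + \sum_(j < m.+1) 'C(2 * j + t, j)
  = 'C(t + 2 * m + 2, m).
Proof.
elim: m => [|m IHm]; first by rewrite big_ord0 big_ord_recl big_ord0 !bin0.
rewrite [\sum_(w < m.+1) 'C(_ + 3, _)]big_ord_recr.
rewrite [\sum_(j < m.+2) _]big_ord_recr /= addnACA IHm.
rewrite (_ : 2 * m.+1 + t = (t + 2 * m + 1).+1); last by lia.
rewrite (_ : t + 2 * m.+1 + 2 = (t + 2 * m + 3).+1); last by lia.
rewrite (binS (t + 2 * m + 3)) (_ : t + 2 * m + 3 = (t + 2 * m + 2).+1); last by lia.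
rewrite (binS (t + 2 * m + 2) m) (_ : t + 2 * m + 2 = (t + 2 * m + 1).+1); lia.
Qed.

(** For u = n - 1 - t the sum over i consists of C(2j+t, j) with j < u, and the nonzero
    [desc_increment] are C(t+2w+3, w) with w < u - 1. Together they telescope to C(t+2u, u-1), which
    the ballot number lacks. *)
Lemma completions_closed n t : 0 < n -> t < n ->
  completions t n.-1 0 [::] +
    \sum_(2 <= i < (n - t).+1) 'C(2 * n - t - 2 * i, n - t - i) =
  'C(2 * n - t - 2, n - t - 1).
Proof.
case: n => // m _; rewrite ltnS => le_tm /=.
rewrite (@completionsE m.+3) // 1?sum_descsum //; last by lia.
rewrite -(subnKC le_tm); move: (m - t) => u.
rewrite (_ : 2 * (t + u).+1 - t - 2 = t + 2 * u); last by lia.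
rewrite (_ : (t + u).+1 - t - 1 = u); last by lia.
rewrite (_ : (t + u).+1 - t = u.+1); last by lia.
rewrite -prefixesE -addnA; congr (_ + _).
have -> : \sum_(2 <= i < u.+2) 'C(2 * (t + u).+1 - t - 2 * i, u.+1 - i) =
    \sum_(j < u) 'C(2 * j + t, j).
  rewrite big_add1 big_add1 big_mkord (reindex_inj rev_ord_inj).
  by apply: eq_bigr => -[j ltj] _ /=; congr 'C(_, _); lia.
case: u => [|u].
  rewrite [X in _ + X]big_ord0 addn0 big1 // => -[v ltv] _ /=.
  by rewrite /desc_increment; case: leqP => //; lia.
rewrite (_ : t + 2 * u.+1 = t + 2 * u + 2) -?sum_bin_telescope; last by lia.
congr (_ + _).
rewrite -(big_mkord xpredT (fun v => desc_increment v t)).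
rewrite (big_cat_nat (n := t + 3)) //=; last by lia.
rewrite big_nat big1 ?add0n => [|v /andP[_ ltv]]; last first.
  by rewrite /desc_increment; case: leqP => //; lia.
rewrite -{1}[t + 3]add0n big_addn (_ : (t + u.+1).+2 - (t + 3) = u); last by lia.
rewrite big_mkord; apply: eq_bigr => -[w ltw] _ /=; rewrite /desc_increment.
by rewrite (_ : t + 3 <= _ = true); [congr 'C(_, _); lia | lia].
Qed.

(** * States of pattern-avoiding sequences *)

(* The value b occurs in u strictly before an occurrence of a; follows u x x    *)
(* means that x is repeated.                                                    *)
Definition follows (u : seq nat) (b a : nat) : Prop :=
  exists i j, [/\ i < j, j < size u, nth 0 u i = b & nth 0 u j = a].

Lemma follows_rcons u v b a :
  follows (rcons u v) b a <-> follows u b a \/ a = v /\ b \in u.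
Proof.
split=> [[i] [j] [ltij]|].
  rewrite size_rcons ltnS => lej; rewrite !nth_rcons.
  have lti : i < size u by lia.
  rewrite lti; case: ltngtP lej => // [ltj _ <- <-|eqj _ <- <-].
    by left; exists i, j.
  by right; rewrite mem_nth.
case=> [[i] [j] [ltij ltj <- <-]|[-> /(nthP 0)[i lti <-]]].
  by exists i, j; rewrite size_rcons !nth_rcons ltj (ltn_trans ltij ltj) leqW.
by exists i, (size u); rewrite size_rcons !nth_rcons lti ltnn eqxx.
Qed.

Lemma follows_mem u b a : follows u b a -> (b \in u) /\ (a \in u).
Proof. by case=> i [j] [ltij ltj <- <-]; rewrite !mem_nth // (ltn_trans ltij). Qed.

Definition pattern_free (u : seq nat) : bool :=
  [forall i : 'I_(size u), forall j : 'I_(size u), forall k : 'I_(size u),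
     (i < j) && (j < k) ==>
       ~~ (nth 0 u j < nth 0 u i < nth 0 u k) &&
       ~~ ((nth 0 u j == nth 0 u i) && (nth 0 u k < nth 0 u i))].

Lemma pattern_freeP u :
  reflect (forall i j k, i < j -> j < k -> k < size u ->
             ~ (nth 0 u j < nth 0 u i < nth 0 u k) /\
             ~ (nth 0 u j = nth 0 u i /\ nth 0 u k < nth 0 u i))
          (pattern_free u).
Proof.
apply: (iffP idP) => [free i j k ltij ltjk ltk | free].
  have ltj := ltn_trans ltjk ltk; have lti := ltn_trans ltij ltj.
  move/forallP/(_ (Ordinal lti))/forallP/(_ (Ordinal ltj))/forallP: free.
  move/(_ (Ordinal ltk)); rewrite /= ltij ltjk /= => /andP[/negP f102 /negP f110].
  by split=> // -[eqji ltki]; apply: f110; rewrite eqji eqxx.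
do 3![apply/forallP => ?]; apply/implyP => /andP[ltij ltjk].
have [f102 f110] := free _ _ _ ltij ltjk (ltn_ord _).
by apply/andP; split; apply/negP => // /andP[/eqP eqji ltki]; apply: f110.
Qed.

(** A new last entry can only be the third letter of a pattern. *)
Lemma pattern_free_rcons u v :
  pattern_free (rcons u v) <->
  pattern_free u /\
  (forall b a, follows u b a -> ~ (a < b < v) /\ ~ (a = b /\ v < b)).
Proof.
split=> [/pattern_freeP free | [/pattern_freeP free freev]].
  split; last first.
    move=> b a [i] [j] [ltij ltj <- <-].
    have := free i j (size u) ltij ltj; rewrite size_rcons ltnS leqnn => /(_ isT).
    by rewrite !nth_rcons ltj (ltn_trans ltij ltj) ltnn eqxx.
  apply/pattern_freeP => i j k ltij ltjk ltk.
  have := free i j k ltij ltjk; rewrite size_rcons ltnS => /(_ (ltnW ltk)).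
  by rewrite !nth_rcons ltk (ltn_trans ltjk ltk) (ltn_trans ltij (ltn_trans ltjk ltk)).
apply/pattern_freeP => i j k ltij ltjk; rewrite size_rcons ltnS => lek.
have ltj := leq_trans ltjk lek; have lti := ltn_trans ltij ltj.
rewrite !nth_rcons ltj lti; case: (ltngtP k) lek => // [ltk _|eqk _]; first exact: free.
by apply: freev; exists i, j.
Qed.

(** * Gap states and their transitions *)

(* The present values p_i, recovered from p_0 = R and the gaps.                 *)
Definition pos (R : nat) (gs : seq nat) (i : nat) : nat :=
  R + sumn [seq g.+1 | g <- take i gs].

Definition top (R : nat) (gs : seq nat) : nat := pos R gs (size gs).

Lemma pos0 R gs : pos R gs 0 = R.
Proof. by rewrite /pos take0 addn0. Qed.

Lemma posS R gs i : i < size gs -> pos R gs i.+1 = pos R gs i + (nth 0 gs i).+1.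
Proof.
by move=> lti; rewrite /pos (take_nth 0) // map_rcons sumn_rcons addnA.
Qed.

Lemma pos_le R gs i j : i <= j <= size gs -> pos R gs i <= pos R gs j.
Proof.
elim: j => [|j IHj] /andP[]; first by rewrite leqn0 => /eqP->.
rewrite leq_eqVlt => /orP[/eqP-> // | ]; rewrite ltnS => leij ltj.
by rewrite posS // (leq_trans (IHj _)) ?leij ?leq_addr // ltnW.
Qed.

Lemma pos_ge R gs i : R <= pos R gs i.
Proof. exact: leq_addr. Qed.

Lemma posS_le_top R gs i : i < size gs -> pos R gs i.+1 <= top R gs.
Proof. by move=> lti; apply: pos_le; rewrite lti leqnn. Qed.

Lemma pos_take_cat R gs i s j : i <= size gs -> j <= i ->
  pos R (take i gs ++ s) j = pos R gs j.
Proof.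
move=> lei leji; rewrite /pos takel_cat ?take_takel //.
by rewrite size_takel.
Qed.

Lemma top_rcons R gs g : top R (rcons gs g) = top R gs + g.+1.
Proof.
rewrite /top size_rcons posS ?size_rcons // nth_rcons ltnn eqxx; congr (_ + _).
by rewrite -cats1 -{1}(take_size gs) pos_take_cat.
Qed.

Lemma sum_positions R gs i (f : nat -> nat) : i <= size gs ->
  \sum_(R <= v < pos R gs i) f v =
  \sum_(l < i) (f (pos R gs l) + \sum_(a < nth 0 gs l) f (pos R gs l + a.+1)).
Proof.
elim: i => [|i IHi] lti; first by rewrite pos0 big_geq // big_ord0.
rewrite (big_cat_nat (n := pos R gs i)) ?pos_ge //=; last first.
  by rewrite posS // leq_addr.
rewrite IHi; last exact: ltnW.
rewrite big_ord_recr; congr (_ + _); rewrite posS // addnS big_nat_recl ?leq_addr //.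
congr (_ + _); rewrite -{1}[pos R gs i]add0n big_addn addKn big_mkord.
by apply: eq_bigr => a _; rewrite addnS addnC.
Qed.

(** [state_base] forbids entries below R; [state_repeat] and [state_descent] make all of [R, top]
    admissible. Values above the top are left open, since they are allowed before a descent and not
    after it. *)
Record gap_state (u : seq nat) (R : nat) (gs : seq nat) : Prop := GapState {
  state_repeat : forall x, follows u x x -> x <= R;
  state_base : R = 0 \/ follows u R R;
  state_descent : forall b a, follows u b a -> a < b -> top R gs <= b;
  state_in : forall i, i <= size gs -> pos R gs i \in u;
  state_out : forall i v, i < size gs ->
    pos R gs i < v < pos R gs i.+1 -> v \notin u
}.

Lemma gap_state_free u R gs v : gap_state u R gs -> pattern_free u ->
  R <= v <= top R gs -> pattern_free (rcons u v).
Proof.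
move=> [rep _ dsc _ _] free /andP[leRv lev]; apply/pattern_free_rcons; split=> //.
move=> b a fol; split=> [/andP[ltab ltbv]|[eqab ltv]].
  by have := dsc _ _ fol ltab; lia.
by rewrite eqab in fol; have := rep _ fol; lia.
Qed.

Lemma gap_state_low u R gs v : gap_state u R gs -> v < R ->
  ~ pattern_free (rcons u v).
Proof.
move=> [_ base _ _ _] ltv /pattern_free_rcons[_ free].
by case: base => [R0|/free[_ []]//]; move: ltv; rewrite R0.
Qed.

Lemma pattern_free_high u M a v : follows u M a -> a < M -> M < v ->
  ~ pattern_free (rcons u v).
Proof.
by move=> fol ltaM ltMv /pattern_free_rcons[_ /(_ _ _ fol)[]]; rewrite ltaM ltMv.
Qed.

(** The repeated p_i becomes the base, and p_{i+1}, now followed by something smaller, the top. *)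
Lemma gap_state_repeat u R gs i : gap_state u R gs -> i < size gs ->
  gap_state (rcons u (pos R gs i)) (pos R gs i) [:: nth 0 gs i].
Proof.
move=> [rep _ dsc inu outu] lti.
have leRp := pos_ge R gs i; have lep := posS_le_top R lti.
have topE : top (pos R gs i) [:: nth 0 gs i] = pos R gs i.+1.
  by rewrite posS // {1}/top {1}/pos /= addn0.
split.
- by move=> x /follows_rcons[/rep|[-> _]] //; lia.
- by right; apply/follows_rcons; right; rewrite inu // ltnW.
- move=> b a /follows_rcons[fol lta|[-> inb] ltb].
    by rewrite topE (leq_trans lep) // (dsc _ _ fol).
  rewrite topE leqNgt; apply/negP => ltp.
  by have := outu i b lti; rewrite ltb ltp inb => /(_ isT).
- move=> [|[|//]] _; first by rewrite pos0 mem_rcons mem_head.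
  by rewrite -[pos _ _ 1]/(top _ _) topE mem_rcons in_cons inu ?orbT.
- move=> [|//] v _; rewrite pos0 -[pos _ _ 1]/(top _ _) topE => /andP[ltv lev].
  by rewrite mem_rcons in_cons negb_or (outu i) ?ltv ?andbT // neq_ltn ltv orbT.
Qed.

(** The new entry repeats nothing, so R stays, while p_{i+1} becomes the top. *)
Lemma gap_state_split u R gs i a : gap_state u R gs -> i < size gs ->
  a < nth 0 gs i ->
  gap_state (rcons u (pos R gs i + a.+1)) R
    (take i gs ++ [:: a; nth 0 gs i - a.+1]).
Proof.
move=> [rep base dsc inu outu] lti lta; set gs' := take i gs ++ _.
set v := pos R gs i + a.+1.
have leRp := pos_ge R gs i; have lep := posS_le_top R lti.
have szt : size (take i gs) = i by rewrite size_takel // ltnW.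
have szg : size gs' = i.+2 by rewrite size_cat szt addn2.
have posE j : j <= i -> pos R gs' j = pos R gs j.
  by move=> lej; rewrite pos_take_cat // ltnW.
have pos1 : pos R gs' i.+1 = v.
  by rewrite posS ?szg // posE // nth_cat szt ltnn subnn.
have pos2 : pos R gs' i.+2 = pos R gs i.+1.
  rewrite posS ?szg // pos1 nth_cat szt ltnNge leqnSn /= subSnn /= posS // /v; lia.
have vP : pos R gs i < v < pos R gs i.+1 by rewrite posS // /v; lia.
have vNu : v \notin u by apply: outu vP.
have topE : top R gs' = pos R gs i.+1 by rewrite /top szg.
split.
- move=> x /follows_rcons[/rep //|[-> inv]]; by rewrite inv in vNu.
- by case: base => [|fol]; [left | right; apply/follows_rcons; left].
- move=> b c /follows_rcons[fol ltc|[-> inb] ltb].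
    by rewrite topE (leq_trans lep) // (dsc _ _ fol).
  rewrite topE leqNgt; apply/negP => ltp.
  by have := outu i b lti; rewrite inb ltp andbT => /(_ _)/implyP; lia.
- move=> j; rewrite szg mem_rcons in_cons.
  case: (ltngtP j i.+1) => [ltj _|ltj lej|-> _]; last by rewrite pos1 eqxx.
    by rewrite posE // inu ?orbT //; lia.
  by rewrite (_ : j = i.+2) ?pos2 ?inu ?orbT //; lia.
move=> j x; rewrite szg mem_rcons in_cons negb_or => ltj xP.
have [ltji|leij] := ltnP j i.
  move: xP; rewrite (posE j (ltnW ltji)) (posE j.+1 ltji) => xP.
  rewrite (outu j x _ xP) ?andbT; last by lia.
  have : pos R gs j.+1 <= pos R gs i by apply: pos_le; lia.
  by lia.
have [eqj|eqj] : j = i \/ j = i.+1 by lia.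
  move: xP; rewrite eqj posE // pos1 => xP; rewrite (outu i x) //; lia.
move: xP; rewrite eqj pos1 pos2 => xP; rewrite (outu i x) //; lia.
Qed.

Lemma gap_state_top u R gs : gap_state u R gs ->
  gap_state (rcons u (top R gs)) (top R gs) [::].
Proof.
move=> [rep base dsc inu outu]; have leR : R <= top R gs by apply: pos_ge.
have topE : top (top R gs) [::] = top R gs by rewrite {1}/top pos0.
split=> //.
- by move=> x /follows_rcons[/rep|[-> _]] //; lia.
- by right; apply/follows_rcons; right; rewrite inu.
- rewrite topE => b a /follows_rcons[fol ltab|[-> _] ltb]; last exact: ltnW.
  exact: dsc fol ltab.
by move=> [|//] _; rewrite pos0 mem_rcons mem_head.
Qed.

Lemma gap_state_ascent u R gs g : gap_state u R gs ->
  (forall b a, follows u b a -> b <= a) -> {in u, forall x, x <= top R gs} ->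
  gap_state (rcons u (top R gs + g.+1)) R (rcons gs g).
Proof.
move=> [rep base dsc inu outu] asc le_top.
have posE j : j <= size gs -> pos R (rcons gs g) j = pos R gs j.
  by move=> lej; rewrite -cats1 -{1}(take_size gs) pos_take_cat.
have posT : pos R (rcons gs g) (size gs).+1 = top R gs + g.+1.
  by rewrite -top_rcons /top size_rcons.
split.
- move=> x /follows_rcons[/rep //|[-> /le_top]]; lia.
- by case: base => [|fol]; [left | right; apply/follows_rcons; left].
- move=> b a /follows_rcons[/asc|[-> /le_top]]; lia.
- move=> j; rewrite size_rcons mem_rcons in_cons leq_eqVlt => /orP[/eqP->|].
    by rewrite posT eqxx.
  by rewrite ltnS => lej; rewrite posE // inu ?orbT.
move=> j x; rewrite size_rcons mem_rcons in_cons negb_or ltnS leq_eqVlt.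
case/orP => [/eqP-> | ltj].
  rewrite posE // posT -/(top R gs) => xP; apply/andP; split; first by lia.
  by apply/negP => /le_top; lia.
rewrite !posE //; last by lia.
move=> xP; rewrite (outu j) // andbT.
by have := posS_le_top R ltj; lia.
Qed.

(** * Rank and extensions of a prefix *)

(** The test [i.+1 == size u] replaces the convention e_{n+1} = -1. *)
Definition first_descent (u : seq nat) : nat :=
  (find (fun i => (i.+1 == size u) || (nth 0 u i.+1 < nth 0 u i))
        (iota 0 (size u))).+1.

Definition has_rank (t : nat) (u : seq nat) : bool :=
  first_descent u == \max_(x <- u) x + t + 1.

Lemma find_iota (P : pred nat) n p :
  p < n -> P p -> (forall i, i < p -> ~~ P i) -> find P (iota 0 n) = p.
Proof.
move=> ltpn Pp Pi; rewrite -(subnKC (ltnW ltpn)) iotaD find_cat add0n size_iota.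
rewrite (_ : has P (iota 0 p) = false); last first.
  by apply/hasPn => i; rewrite mem_iota add0n => /Pi.
have [d ->] : exists d, n - p = d.+1 by exists (n - p).-1; lia.
by rewrite /= Pp addn0.
Qed.

Lemma has_rankE t w m (r : seq nat) :
  (forall b a, follows (rcons w m) b a -> b <= a) -> m <= size w ->
  {in r, forall x, x <= m} -> (if r is a :: _ then a < m else true) ->
  has_rank t (rcons w m ++ r) = (size w - m == t).
Proof.
move=> asc lemw ler ltr; set u := rcons w m ++ r.
have lt_wu : size w < size u by rewrite size_cat size_rcons; lia.
have nth_u i : i <= size w -> nth 0 u i = nth 0 (rcons w m) i.
  by move=> lei; rewrite nth_cat size_rcons ltnS lei.
rewrite /has_rank; have -> : first_descent u = (size w).+1.
  rewrite /first_descent (@find_iota _ _ (size w)) //.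
    rewrite /= [nth 0 u (size w)]nth_u // nth_rcons ltnn eqxx nth_cat size_rcons ltnn subnn.
    case: r ltr {ler nth_u lt_wu} @u => [_ u|a r lta u] /=; last by rewrite lta orbT.
    by rewrite /u cats0 size_rcons eqxx.
  move=> i lti; rewrite /= negb_or -leqNgt; apply/andP; split; first by lia.
  rewrite !nth_u //; last by lia.
  by apply: asc; exists i, i.+1; rewrite size_rcons; split.
have -> : \max_(x <- u) x = m.
  apply/eqP; rewrite eqn_leq; apply/andP; split.
    apply/bigmax_leqP_seq => x; rewrite mem_cat mem_rcons in_cons.
    case/orP=> [/orP[/eqP->|inw]|/ler] // _.
    by apply: asc; apply/follows_rcons; right.
  apply: (@leq_bigmax_seq _ _ xpredT id) => //.
  by rewrite mem_cat mem_rcons mem_head.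
by apply/eqP/eqP; lia.
Qed.

Fixpoint extensions (t k : nat) (u : seq nat) : nat :=
  if k is j.+1 then \sum_(v < (size u).+1) extensions t j (rcons u v)
  else pattern_free u && has_rank t u.

Lemma extensions_eq0 t k u : ~ pattern_free u -> extensions t k u = 0.
Proof.
elim: k u => [|k IHk] u Nfree /=; first by move/negP/negbTE: Nfree => ->.
by rewrite big1 // => v _; rewrite IHk // => /pattern_free_rcons[].
Qed.

(** [rcons w m] is the part up to the first descent; its slack c is the rank, as no later entry
    exceeds m. *)
Definition past_descent (c : nat) (u : seq nat) : Prop :=
  exists w m a r, [/\ u = rcons w m ++ a :: r,
    forall b a, follows (rcons w m) b a -> b <= a, a < m,
    {in a :: r, forall x, x <= m} & m <= size w /\ c = size w - m].

Lemma past_descent_rank t c u : past_descent c u -> has_rank t u = (c == t).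
Proof. by move=> [w] [m] [a] [r] [-> asc lta ler [lem ->]]; apply: has_rankE. Qed.

(** The inversion bound no longer restricts reuse of values up to the top, so continuations do not
    depend on the length. *)
Lemma past_descent_le c u x : past_descent c u -> x \in u -> x < size u.
Proof.
move=> [w] [m] [a] [r] [-> asc lta ler [lem _]].
rewrite size_cat size_rcons mem_cat mem_rcons in_cons.
case/orP=> [/orP[/eqP->|inw]|/ler lex]; try lia.
have : x <= m by apply: asc; apply/follows_rcons; right.
by lia.
Qed.

Lemma past_descent_rcons c u x v : past_descent c u -> x \in u -> v <= x ->
  past_descent c (rcons u v).
Proof.
move=> [w] [m] [a] [r] [-> asc lta ler [lem ->]] inx lev.
have lexm : x <= m.
  move: inx; rewrite mem_cat mem_rcons in_cons.
  case/orP=> [/orP[/eqP->//|inw]|/ler //].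
  by apply: asc; apply/follows_rcons; right.
exists w, m, a, (rcons r v); split=> //; first by rewrite rcons_cat rcons_cons.
move=> y; rewrite -rcons_cons mem_rcons in_cons => /orP[/eqP->|/ler //].
exact: leq_trans lev lexm.
Qed.

Record desc_state (c : nat) (u : seq nat) (R : nat) (gs : seq nat) : Prop := DescState {
  desc_free : pattern_free u;
  desc_gaps : gap_state u R gs;
  desc_after : exists2 a, follows u (top R gs) a & a < top R gs;
  desc_past : past_descent c u
}.

(** Serves both the first descent and later entries, hence hypotheses weaker than [desc_state]. *)
Lemma sum_extensions_below_top t k c u R gs :
  pattern_free u -> gap_state u R gs ->
  (forall v, v < top R gs -> past_descent c (rcons u v)) ->
  (forall u R gs, desc_state c u R gs ->
     extensions t k u = (c == t) * (desc k gs).+1) ->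
  \sum_(v < top R gs) extensions t k (rcons u v) = (c == t) * desc k.+1 gs.
Proof.
move=> free st past IH.
rewrite -(big_mkord xpredT (fun v => extensions t k (rcons u v))).
rewrite (big_cat_nat (n := R)) //= ?pos_ge //.
rewrite big_nat big1 ?add0n => [|v /andP[_ ltv]]; last first.
  by apply/extensions_eq0/(gap_state_low st).
rewrite sum_positions // big_distrr; apply: eq_bigr => -[i lti] _ /=.
have lep := posS_le_top R lti; have posi := posS R lti.
have inp : pos R gs i.+1 \in u by apply: (state_in st).
have leR := pos_ge R gs i.
rewrite mulnDr big_distrr; congr (_ + _).
  rewrite (IH _ (pos R gs i) [:: nth 0 gs i]) //.
  have topE : top (pos R gs i) [:: nth 0 gs i] = pos R gs i.+1.
    by rewrite posS // {1}/top {1}/pos /= addn0.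
  split.
  - by apply: gap_state_free st free _; lia.
  - exact: gap_state_repeat.
  - exists (pos R gs i); last by rewrite topE; lia.
    by apply/follows_rcons; right; rewrite topE.
  - by apply: past; lia.
apply: eq_bigr => -[a lta] _ /=.
set gs' := take i gs ++ _.
have topE : top R gs' = pos R gs i.+1.
  have szg : size (take i gs ++ [:: a; nth 0 gs i - a.+1]) = i.+2.
    by rewrite size_cat size_takel ?addn2 // ltnW.
  rewrite /top /gs' szg !posS ?szg // pos_take_cat //; last exact: ltnW.
  rewrite !nth_cat size_takel; last exact: ltnW.
  by rewrite ltnn subnn ltnNge leqnSn /= subSnn /=; lia.
rewrite (IH _ R gs') //; split.
- by apply: gap_state_free st free _; lia.
- exact: gap_state_split.
- exists (pos R gs i + a.+1); last by rewrite topE; lia.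
  by apply/follows_rcons; right; rewrite topE.
- by apply: past; lia.
Qed.

(** The successor is the continuation by copies of the top: once the top is appended, no other entry
    is possible. *)
Lemma extensions_desc t k c u R gs : desc_state c u R gs ->
  extensions t k u = (c == t) * (desc k gs).+1.
Proof.
elim: k u R gs => [|k IHk] u R gs [free st [a fol lta] past].
  by rewrite /= free (past_descent_rank t past) muln1.
have inT : top R gs \in u by case: (follows_mem fol).
have ltT := past_descent_le past inT.
rewrite [LHS]/= -(big_mkord xpredT (fun v => extensions t k (rcons u v))).
rewrite (big_cat_nat (n := top R gs)) //=; last by lia.
rewrite big_mkord (@sum_extensions_below_top _ _ c _ R gs) //; last first.
  by move=> v ltv; apply: past_descent_rcons past inT (ltnW ltv).
rewrite big_ltn; last by lia.
rewrite big_nat big1 => [|v /andP[ltv _]]; last first.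
  by apply/extensions_eq0/(pattern_free_high fol).
have stT := gap_state_top st.
rewrite (IHk _ (top R gs) [::]) ?desc_nil; first by rewrite addn0 -mulnDr addn1.
have topE : top (top R gs) [::] = top R gs by rewrite {1}/top pos0.
split=> //.
- by apply: gap_state_free st free _; rewrite leqnn pos_ge.
- by rewrite topE; exists a => //; apply/follows_rcons; left.
- exact: past_descent_rcons past inT (leqnn _).
Qed.

Lemma pattern_free_ascending u :
  (forall b a, follows u b a -> b <= a) -> pattern_free u.
Proof.
move=> asc; apply/pattern_freeP => i j k ltij ltjk ltk.
have leij : nth 0 u i <= nth 0 u j by apply: asc; exists i, j; split=> //; lia.
have lejk : nth 0 u j <= nth 0 u k by apply: asc; exists j, k.
by lia.
Qed.

(** A next entry equal to, above or below m gives the three summands of [completions]. *)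
Lemma extensions_ascending t k w m R gs : m = top R gs ->
  (forall b a, follows (rcons w m) b a -> b <= a) ->
  gap_state (rcons w m) R gs -> m <= size w ->
  extensions t k (rcons w m) = completions t k (size w - m) gs.
Proof.
elim: k w m R gs => [|k IHk] w m R gs mE asc st lew;
  have free := pattern_free_ascending asc.
  by rewrite /= free -[rcons w m]cats0 (@has_rankE t w m [::]) // cats0.
have lem x : x \in rcons w m -> x <= m.
  rewrite mem_rcons in_cons => /orP[/eqP->//|inw].
  by apply: asc; apply/follows_rcons; right.
have ascS v : m <= v -> forall b a, follows (rcons (rcons w m) v) b a -> b <= a.
  by move=> lemv b a /follows_rcons[/asc//|[-> /lem]] /leq_trans; apply.
rewrite [LHS]/= size_rcons.
rewrite -(big_mkord xpredT (fun v => extensions t k (rcons (rcons w m) v))).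
rewrite (big_cat_nat (n := m)) //=; last by lia.
rewrite big_mkord.
have := @sum_extensions_below_top t k (size w - m) _ R gs free st.
rewrite -mE => ->; first last.
- by move=> u R0 gs0 stu; apply: extensions_desc stu.
- move=> v ltv; exists w, m, v, [::]; rewrite cats1; split=> //.
  by move=> x; rewrite inE => /eqP->; apply: ltnW.
rewrite [LHS]addnC; congr (_ + _).
rewrite big_ltn; last by lia.
congr (_ + _).
  rewrite (IHk _ _ m [::]) //.
  - by congr completions; rewrite size_rcons subSn.
  - by rewrite /top pos0.
  - exact: ascS.
  - by have := gap_state_top st; rewrite -mE.
  - by rewrite size_rcons leqW.
rewrite -{1}[m.+1]add0n big_addn big_mkord.
have -> : (size w).+2 - m.+1 = (size w - m).+1 by lia.
apply: eq_bigr => -[g ltg] _ /=; rewrite (IHk _ _ R (rcons gs g)).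
- by congr completions; rewrite size_rcons; lia.
- by rewrite top_rcons -mE; lia.
- by apply: ascS; lia.
- have -> : g + m.+1 = top R gs + g.+1 by rewrite -mE; lia.
  by apply: gap_state_ascent; rewrite -?mE.
- by rewrite size_rcons; lia.
Qed.

Lemma extensions_nil t n : extensions t n.+1 [::] = completions t n 0 [::].
Proof.
rewrite /= big_ord_recl big_ord0 addn0.
rewrite (@extensions_ascending t n [::] 0 0 [::]) //.
  by move=> b a [i] [j] [ltij] /=; rewrite ltnS leqn0 => /eqP j0; rewrite j0 in ltij.
split=> //.
- by move=> x [i] [j] [ltij] /=; rewrite ltnS leqn0 => /eqP j0; rewrite j0 in ltij.
- by left.
Qed.

(** * Enumeration of inversion sequences *)

Fixpoint invseqs (n : nat) : seq (seq nat) :=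
  if n is m.+1 then [seq rcons u v | u <- invseqs m, v <- iota 0 n] else [:: [::]].

Lemma mem_invseqs n s :
  s \in invseqs n <-> size s = n /\ forall i, i < n -> nth 0 s i <= i.
Proof.
elim: n s => [|n IHn] s.
  rewrite inE; split=> [/eqP-> //|[/eqP]].
  by rewrite size_eq0.
split=> [/allpairsP[[u v] [/IHn[/= szu leu]]]|].
  rewrite (mem_iota 0 n.+1) => ltv ->; rewrite size_rcons szu; split=> // i.
  by rewrite nth_rcons szu ltnS leq_eqVlt => /orP[/eqP->|lti]; rewrite ?ltnn ?eqxx // lti leu.
case: (lastP s) => [[]//|u v] [/eqP]; rewrite size_rcons eqSS => /eqP szu les.
apply/allpairsP; exists (u, v); split=> //=.
  apply/IHn; split=> // i lti; have := les i (leqW lti).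
  by rewrite nth_rcons szu lti.
by have := les n (ltnSn n); rewrite nth_rcons szu ltnn eqxx (mem_iota 0 n.+1).
Qed.

Lemma uniq_invseqs n : uniq (invseqs n).
Proof.
elim: n => [|n IHn] //.
apply: (@allpairs_uniq _ _ _ rcons (invseqs n) (iota 0 n.+1)) => //.
  exact: iota_uniq.
by move=> [u v] [u' v'] _ _ /= /rcons_inj[-> ->].
Qed.

Lemma count_invseqs t n :
  count (fun u => pattern_free u && has_rank t u) (invseqs n) =
  extensions t n [::].
Proof.
(* The sum over prefixes of length j depends only on j + k; k = 0 gives the count. *)
have sumE j k : \sum_(u <- invseqs j) extensions t k u = extensions t (j + k) [::].
  elim: j k => [|j IHj] k; first by rewrite /= big_seq1.
  rewrite addSnnS -IHj.
  rewrite [invseqs j.+1]/([seq rcons u v | u <- invseqs j, v <- iota 0 j.+1]).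
  rewrite big_allpairs_dep big_seq [RHS]big_seq.
  apply: eq_bigr => u /mem_invseqs[szu _].
  by rewrite /= szu -(big_mkord xpredT (fun v => extensions t k (rcons u v))).
rewrite -[in RHS](addn0 n) -sumE -sum1_count big_mkcond.
by apply: eq_bigr => u _ /=; case: (_ && _).
Qed.

(** * Inversion sequences as words *)

Definition word (n : nat) (e : {ffun 'I_n -> 'I_n}) : seq nat :=
  [seq (e i : nat) | i <- enum 'I_n].

Lemma size_word n (e : {ffun 'I_n -> 'I_n}) : size (word e) = n.
Proof. by rewrite size_map size_enum_ord. Qed.

Lemma nth_word n (e : {ffun 'I_n -> 'I_n}) (i : 'I_n) : nth 0 (word e) i = e i.
Proof. by rewrite (nth_map i) ?size_enum_ord // nth_ord_enum. Qed.

Lemma word_inj n : injective (@word n).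
Proof.
by move=> e f eq_ef; apply/ffunP => i; apply: val_inj; rewrite /= -!nth_word eq_ef.
Qed.

Lemma order_iso102 x y z :
  order_iso [tuple x; y; z] [tuple 1; 0; 2] = (y < x < z).
Proof.
apply/forallP/idP => [iso|/andP[ltyx ltxz]].
  have /forallP := iso (@Ordinal 3 0 isT); move=> iso0.
  have /andP[/eqP + _] := iso0 (@Ordinal 3 2 isT).
  have /forallP := iso (@Ordinal 3 1 isT).
  move=> /(_ (@Ordinal 3 0 isT)) /andP[/eqP + _].
  by rewrite !(tnth_nth 0) /= => -> ->.
case=> [[|[|[|//]]] lta]; apply/forallP; case=> [[|[|[|//]]] ltb];
  by rewrite !(tnth_nth 0) /=; lia.
Qed.

Lemma order_iso110 x y z :
  order_iso [tuple x; y; z] [tuple 1; 1; 0] = (y == x) && (z < x).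
Proof.
apply/forallP/idP => [iso|/andP[/eqP eqyx ltzx]].
  have /forallP := iso (@Ordinal 3 1 isT).
  move=> /(_ (@Ordinal 3 0 isT)) /andP[_ /eqP +].
  have /forallP := iso (@Ordinal 3 2 isT).
  move=> /(_ (@Ordinal 3 0 isT)) /andP[/eqP + _].
  by rewrite !(tnth_nth 0) /= => -> ->.
case=> [[|[|[|//]]] lta]; apply/forallP; case=> [[|[|[|//]]] ltb];
  by rewrite !(tnth_nth 0) /=; lia.
Qed.

Lemma pattern_free_word n (e : {ffun 'I_n -> 'I_n}) :
  pattern_free (word e) =
  avoids e [tuple 1; 0; 2] && avoids e [tuple 1; 1; 0].
Proof.
rewrite /avoids /contains; apply/pattern_freeP/andP => [free | [N102 N110] i j k].
  split; apply/existsP => -[i /existsP[j /existsP[k /and3P[ltij ltjk]]]];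
    have ltk : k < size (word e) by rewrite size_word.
    rewrite order_iso102 -!nth_word => pat.
    by case: (free i j k ltij ltjk ltk).
  rewrite order_iso110 -!nth_word => /andP[/eqP eqji ltki].
  by case: (free i j k ltij ltjk ltk) => _; apply.
rewrite size_word => ltij ltjk ltk; have ltj := ltn_trans ltjk ltk.
have lti := ltn_trans ltij ltj.
rewrite (nth_word e (Ordinal lti)) (nth_word e (Ordinal ltj)) (nth_word e (Ordinal ltk)).
split=> [pat|[eqji ltki]]; [move/existsP: N102 | move/existsP: N110]; apply;
  exists (Ordinal lti); apply/existsP; exists (Ordinal ltj); apply/existsP;
  exists (Ordinal ltk).
  by rewrite order_iso102 ltij ltjk.
by rewrite order_iso110 ltij ltjk ltki eqji eqxx.
Qed.

Lemma entry_word n (e : {ffun 'I_n -> 'I_n}) i :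
  entry e i = if i < n then Posz (nth 0 (word e) i) else (- 1)%R.
Proof.
rewrite /entry; case: insubP => [j _ <-|/negbTE-> //].
by rewrite ltn_ord nth_word.
Qed.

Lemma fdes_word n (e : {ffun 'I_n -> 'I_n}) : fdes e = first_descent (word e).
Proof.
rewrite /fdes /first_descent size_word; congr _.+1; apply: eq_in_find => i.
rewrite mem_iota => /andP[_ ltin]; rewrite !entry_word ltin.
by case: (ltngtP i.+1 n) ltin => // [ltSi _|-> _]; lia.
Qed.

Lemma maxe_word n (e : {ffun 'I_n -> 'I_n}) : maxe e = \max_(x <- word e) x.
Proof. by rewrite /maxe big_map big_enum. Qed.

Lemma rank_word n t (e : {ffun 'I_n -> 'I_n}) :
  (rank e == Posz t) = has_rank t (word e).
Proof. by rewrite /rank /has_rank -fdes_word -maxe_word; lia. Qed.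

Lemma word_invseqs n (e : {ffun 'I_n -> 'I_n}) :
  is_invseq e <-> word e \in invseqs n.
Proof.
split=> [/forallP le_e|/mem_invseqs[_ le_e]].
  apply/mem_invseqs; rewrite size_word; split=> // i lti.
  by rewrite (nth_word e (Ordinal lti)); apply: (le_e (Ordinal lti)).
by apply/forallP => i; rewrite -nth_word le_e.
Qed.

Lemma card_invseqs n (Q : pred (seq nat)) :
  #|[set e : {ffun 'I_n -> 'I_n} | is_invseq e && Q (word e)]| = count Q (invseqs n).
Proof.
rewrite cardE -(size_map (@word n)) -size_filter; apply/perm_size/uniq_perm.
- by rewrite map_inj_uniq ?enum_uniq //; apply: word_inj.
- by rewrite filter_uniq ?uniq_invseqs.
move=> s; rewrite mem_filter; apply/mapP/andP => [[e] | [Qs]].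
  by rewrite mem_enum inE => /andP[/word_invseqs ine Qe] ->.
move=> ins; have [szs les] := (mem_invseqs n s).1 ins.
(* The default of [insubd] is never reached: the i-th entry is at most i < n. *)
pose e : {ffun 'I_n -> 'I_n} := [ffun i : 'I_n => insubd i (nth 0 s i)].
have eE : word e = s.
  apply: (@eq_from_nth _ 0) => [|i]; rewrite size_word ?szs // => lti.
  rewrite (nth_word e (Ordinal lti)) ffunE val_insubd /=.
  by rewrite (leq_ltn_trans (les i lti) lti).
exists e; last by rewrite eE.
by rewrite mem_enum inE eE Qs andbT; apply/word_invseqs; rewrite eE.
Qed.

Theorem proposition5p17 (n t : nat) (hn : 2 <= n) (ht : t <= n - 1) :
  (Posz #|[set e : {ffun 'I_n -> 'I_n} |
            [&& is_invseq e, avoids e [tuple 1%N; 0%N; 2%N],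
                avoids e [tuple 1%N; 1%N; 0%N] & rank e == Posz t]]|
   = Posz 'C(2 * n - t - 2, n - t - 1)
     - \sum_(2 <= i < (n - t).+1) Posz 'C(2 * n - t - 2 * i, n - t - i))%R.
Proof.
have -> : [set e : {ffun 'I_n -> 'I_n} |
    [&& is_invseq e, avoids e [tuple 1; 0; 2], avoids e [tuple 1; 1; 0]
      & rank e == Posz t]] =
    [set e | is_invseq e && (pattern_free (word e) && has_rank t (word e))].
  by apply/setP => e; rewrite !inE pattern_free_word rank_word -andbA.
rewrite (@card_invseqs n (fun u => pattern_free u && has_rank t u)) count_invseqs.
have {1}-> : n = n.-1.+1 by lia.
rewrite extensions_nil -(@completions_closed n t); [|lia|lia].
rewrite PoszD (big_morph Posz PoszD (erefl _)).
by rewrite GRing.addrK.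
Qed.
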